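(* Let $(A,H,D)$ be a spectral triple, let $\varphi,\psi\in S(\bar A)$ be two states with $d_D(\varphi,\psi)<\infty$, and let $B$ be any complex Banach subspace of $\mathcal{B}(H)$ containing $\mathrm{Im}(\nabla)=\{[D,a]:a\in A\}$. Define $$W(\varphi,\psi):=\inf_{\Phi\in B^*}\big\{\|\Phi\| : \nabla^*\Phi=\varphi_0-\psi_0\big\}.$$ Then: (i) the infimum is well-defined, i.e. the set of $\Phi\in B^*$ satisfying $\nabla^*\Phi=\varphi_0-\psi_0$ is not empty; (ii) the infimum is in fact a minimum; (iii) $W(\varphi,\psi)=d_D(\varphi,\psi)$. In particular, $W(\varphi,\psi)$ is independent of the choice of $B$.
   Context: A spectral triple $(A,H,D)$ consists of an associative (not necessarily commutative, not necessarily unital) complex $*$-algebra $A$ acting faithfully by bounded operators on a complex Hilbert space $H$ (elements of $A$ are identified with the operators representing them), together with a selfadjoint operator $D$ on $H$ such that, for all $a\in A$, the commutator $[D,a]$ is bounded (and is regarded as an element of the algebra $\mathcal{B}(H)$ of bounded operators on $H$) and $a(1+D^2)^{-1}$ is a compact operator. $\bar A$ denotes the closure of $A$ in the operator norm on $H$ (a $C^*$-algebra), and $S(\bar A)$ its set of states (positive linear functionals of norm $1$). For a state $\varphi$ of $\bar A$, $\varphi_0$ denotes its restriction to $A$. The spectral distance between $\varphi,\psi\in S(\bar A)$ is $$d_D(\varphi,\psi):=\sup_{a\in A}\big\{|\varphi(a)-\psi(a)| : \|[D,a]\|\le 1\big\}\in[0,+\infty],$$ where $\|\cdot\|$ is the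 operator norm. $\nabla$ is the linear map $\nabla: A\to\mathcal{B}(H)$, $\nabla a:=[D,a]$. For a Banach subspace $B\subseteq\mathcal{B}(H)$ (with the operator norm) containing $\mathrm{Im}(\nabla)$, $B^*$ is its Banach dual with norm $\|\Phi\|=\sup_{b\in B,\,b\ne0}|\Phi(b)|/\|b\|$. The pullback $\nabla^*:B^*\to\mathcal{L}(A,\mathbb{C})$, with values in the linear maps $A\to\mathbb{C}$, is $\nabla^*\Phi(a):=\Phi(\nabla a)$ for all $\Phi\in B^*$, $a\in A$. *)

(* Defs.v *)
From HB Require Import structures.
From mathcomp Require Import all_boot all_order all_algebra.
From mathcomp Require Import all_classical all_reals all_analysis.
From mathcomp Require Import complex.

Set Implicit Arguments.
Unset Strict Implicit.
Unset Printing Implicit Defensive.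

Import Order.TTheory GRing.Theory Num.Theory.
Import numFieldNormedType.Exports.

Local Open Scope classical_set_scope.
Local Open Scope ring_scope.
Local Open Scope complex_scope.

(* The norm of a normed module over R[i] takes its values in R[i]; this is the
   same number as an element of R. *)
Definition rnorm (R : realType) (V : normedZmodType R[i]) (x : V) : R :=
  complex.Re `|x|.

Lemma rnormE (R : realType) (V : normedModType R[i]) (x : V) : (rnorm x)%:C = `|x|.
Proof.
rewrite /rnorm; have := normr_ge0 x; case: (`|x|) => a b /=.
by rewrite lecE /= => /andP[/eqP -> _].
Qed.

Section RNorm.
Context (R : realType) (V : normedModType R[i]).
Implicit Types x y : V.

Lemma rnorm_ge0 x : 0 <= rnorm x.
Proof. by rewrite -lecR rnormE; exact: normr_ge0. Qed.

Lemma ler_rnormD x y : rnorm (x + y) <= rnorm x + rnorm y.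
Proof. by rewrite -lecR rmorphD /= !rnormE; exact: ler_normD. Qed.

Lemma rnormZ (k : R[i]) x : rnorm (k *: x) = rnorm (k : R[i]^o) * rnorm x.
Proof.
apply: (@complexI R); rewrite rmorphM /= rnormE normrZ.
by rewrite !rnormE.
Qed.

Lemma rnorm0_eq0 x : rnorm x = 0 -> x = 0.
Proof. by move=> x0; apply/normr0_eq0; rewrite -rnormE x0. Qed.

Lemma rnorm_gt0 x : x != 0 -> 0 < rnorm x.
Proof.
move=> x0; rewrite lt_neqAle rnorm_ge0 andbT eq_sym.
by apply: contra x0 => /eqP/rnorm0_eq0 ->.
Qed.

End RNorm.


Section CLin.
Context (R : realType) (V W : normedModType R[i]).

Definition clin_pred : {pred V -> W} :=
  fun f => `[< linear f /\ continuous f >].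

Record clin := Clin { clin_fun :> V -> W; _ : clin_fun \in clin_pred }.

HB.instance Definition _ := [isSub for clin_fun].
HB.instance Definition _ := [Choice of clin by <:].

Lemma clinP (f : clin) : linear f /\ continuous f.
Proof. by case: f => f /= /asboolP. Qed.

HB.instance Definition _ (f : clin) :=
  GRing.isLinear.Build R[i] V W *:%R f (clinP f).1.

Lemma clin_submod_closed : submod_closed clin_pred.
Proof.
split.
  apply/asboolP; split; first by move=> k x y /=; rewrite scaler0 addr0.
  exact: cst_continuous.
move=> k f g /asboolP[lf cf] /asboolP[lg cg]; apply/asboolP; split.
  move=> l x y; rewrite !fctE lf lg !scalerDr !scalerA [k * l]mulrC.
  by rewrite -!addrA; congr (_ + _); rewrite addrCA.
by move=> x; apply: cvgD; [apply: cvgZr; exact: cf|exact: cg].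
Qed.

HB.instance Definition _ :=
  GRing.isSubmodClosed.Build R[i] (V -> W) clin_pred clin_submod_closed.
HB.instance Definition _ := [SubChoice_isSubLmodule of clin by <:].

(* When V is trivial the set is empty and its sup is 0. *)
Definition opnorm (f : clin) : R :=
  sup [set rnorm (f x) / rnorm x | x in [set x | x != 0]].

Lemma clin_bounded (f : clin) :
  exists2 M : R, 0 <= M & forall x, rnorm (f x) <= M * rnorm x.
Proof.
have /linear_bounded_continuous/linear_boundedP/pinfty_ex_gt0 := (clinP f).2.
move=> [[a b] M0 fM]; move: M0; rewrite ltcE /= => /andP[/eqP b0 a0].
exists a; first exact: ltW.
by move=> x; rewrite -lecR rmorphM /= !rnormE -[a%:C]complexr0 -b0; exact: fM.
Qed.

End CLin.

Section OpNorm.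
Context (R : realType) (V W : normedModType R[i]).
Implicit Types f g : clin V W.

Let opset f := [set rnorm (f x) / rnorm x | x in [set x | x != 0]].

Lemma opnorm_ub f x : rnorm (f x) <= opnorm f * rnorm x.
Proof.
have [->|x0] := eqVneq x 0.
  by rewrite linear0 /rnorm !normr0 mulr0.
have xp := rnorm_gt0 x0.
rewrite -ler_pdivrMr//; apply: ub_le_sup; last by exists x.
have [M M0 fM] := clin_bounded f; exists M => _ [y /= y0 <-].
rewrite ler_pdivrMr; first exact: fM.
exact: rnorm_gt0.
Qed.

Lemma opnorm_le f (M : R) : 0 <= M ->
  (forall x, rnorm (f x) <= M * rnorm x) -> opnorm f <= M.
Proof.
move=> M0 fM; rewrite /opnorm -/(opset f).
have [->|/set0P S0] := eqVneq (opset f) set0; first by rewrite sup0.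
apply: ge_sup => // _ [y /= y0 <-].
rewrite ler_pdivrMr; first exact: fM.
exact: rnorm_gt0.
Qed.

Lemma opnorm_ge0 f : 0 <= opnorm f.
Proof.
have [E|/set0P[_ [x /= x0 _]]] := eqVneq (opset f) set0.
  by rewrite /opnorm -/(opset f) E sup0.
have xp := rnorm_gt0 x0.
rewrite -(pmulr_lge0 _ xp); exact: le_trans (rnorm_ge0 (f x)) (opnorm_ub f x).
Qed.

Let cnorm f : R[i] := (opnorm f)%:C.

Let cnormD f g : cnorm (f + g) <= cnorm f + cnorm g.
Proof.
rewrite -rmorphD lecR; apply: opnorm_le; first by rewrite addr_ge0// opnorm_ge0.
move=> x; rewrite mulrDl; apply: (le_trans (ler_rnormD (f x) (g x))).
by rewrite lerD// opnorm_ub.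
Qed.

Let opnormZ_le (k : R[i]) f : opnorm (k *: f) <= rnorm (k : R[i]^o) * opnorm f.
Proof.
apply: opnorm_le; first by rewrite mulr_ge0 ?rnorm_ge0 ?opnorm_ge0.
move=> x; rewrite [X in rnorm X](_ : _ = k *: f x)// rnormZ -mulrA.
by rewrite ler_wpM2l ?rnorm_ge0 ?opnorm_ub.
Qed.

Let cnormZ (k : R[i]) f : cnorm (k *: f) = `|k| * cnorm f.
Proof.
rewrite -[`|k|]/(`|k : R[i]^o|) -rnormE -rmorphM; congr (_ %:C).
apply/eqP; rewrite eq_le opnormZ_le /=.
have [->|k0] := eqVneq k 0.
  by rewrite /rnorm normr0 mul0r opnorm_ge0.
rewrite -[f in leLHS]scale1r -(mulVf k0) -scalerA.
apply: (le_trans (ler_wpM2l (rnorm_ge0 _) (opnormZ_le _ _))).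
rewrite mulrA -[leRHS]mul1r ler_wpM2r ?opnorm_ge0//.
by rewrite -rnormZ /GRing.scale/= mulfV// /rnorm normr1.
Qed.

Let cnorm0_eq0 f : cnorm f = 0 -> f = 0.
Proof.
move/complexI => f0; apply/val_inj/funext => x /=.
apply/rnorm0_eq0/eqP; rewrite eq_le rnorm_ge0 andbT.
by apply: (le_trans (opnorm_ub f x)); rewrite f0 mul0r.
Qed.

HB.instance Definition _ :=
  Lmodule_isNormed.Build R[i] (clin V W) cnormD cnormZ cnorm0_eq0.

Lemma rnorm_clinE f : rnorm f = opnorm f. Proof. by []. Qed.

End OpNorm.

Section Subspace.
Context (R : realType) (V : normedModType R[i]).

Record linear_subspace := Subspace {
  sset : set V ;
  _ : sset 0 ;
  _ : forall (k : R[i]) x y, sset x -> sset y -> sset (k *: x + y) }.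

Lemma subspace0 (S : linear_subspace) : sset S 0. Proof. by case: S. Qed.

Lemma subspaceP (S : linear_subspace) (k : R[i]) x y :
  sset S x -> sset S y -> sset S (k *: x + y).
Proof. by case: S => /= S _; apply. Qed.

Definition subspace_pred (S : linear_subspace) : {pred V} := fun x => `[< sset S x >].

Lemma subspace_submod_closed (S : linear_subspace) :
  submod_closed (subspace_pred S).
Proof.
split; first by apply/asboolP; exact: subspace0.
by move=> k x y /asboolP Sx /asboolP Sy; apply/asboolP; exact: subspaceP.
Qed.

Lemma closure_subspace0 (S : linear_subspace) : closure (sset S) 0.
Proof. by apply: subset_closure; exact: subspace0. Qed.

Lemma closure_subspaceP (S : linear_subspace) (k : R[i]) x y :
  closure (sset S) x -> closure (sset S) y -> closure (sset S) (k *: x + y).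
Proof.
move=> cx cy U Uxy.
have /(_ _ Uxy) : (fun z : V * V => k *: z.1 + z.2) @ nbhs (x, y)
    --> k *: x + y.
  by apply: cvgD; [apply: cvgZr; exact: cvg_fst|exact: cvg_snd].
move=> [[A B] /= [xA yB] AB].
have [a [Sa Aa]] := cx _ xA; have [b [Sb Bb]] := cy _ yB.
by exists (k *: a + b); split; [exact: subspaceP|exact: (AB (a, b))].
Qed.

Definition closure_subspace (S : linear_subspace) : linear_subspace :=
  Subspace (closure_subspace0 S) (@closure_subspaceP S).

End Subspace.

Section SubspaceType.
Context (R : realType) (V : normedModType R[i]) (S : linear_subspace V).

Record subspace_type := SubspaceElt {
  subspace_val :> V ; _ : subspace_val \in subspace_pred S }.

HB.instance Definition _ := [isSub for subspace_val].
HB.instance Definition _ := [Choice of subspace_type by <:].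
HB.instance Definition _ := GRing.isSubmodClosed.Build R[i] V
  (subspace_pred S) (subspace_submod_closed S).
HB.instance Definition _ := [SubChoice_isSubLmodule of subspace_type by <:].

Let snorm (x : subspace_type) : R[i] := `|subspace_val x|.

Let snormD x y : snorm (x + y) <= snorm x + snorm y.
Proof. exact: ler_normD. Qed.

Let snormZ (k : R[i]) x : snorm (k *: x) = `|k| * snorm x.
Proof. exact: normrZ. Qed.

Let snorm0_eq0 x : snorm x = 0 -> x = 0.
Proof. by move=> /normr0_eq0 x0; exact: val_inj. Qed.

HB.instance Definition _ :=
  Lmodule_isNormed.Build R[i] subspace_type snormD snormZ snorm0_eq0.

Lemma subspace_typeP (x : subspace_type) : sset S x.
Proof. by case: x => x /= /asboolP. Qed.

End SubspaceType.
Coercion subspace_type : linear_subspace >-> Sortclass.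

Definition subspace_elt (R : realType) (V : normedModType R[i])
  (S : linear_subspace V) (x : V) (Sx : sset S x) : subspace_type S :=
  @SubspaceElt R V S x (asboolT Sx).

Definition banach (R : realType) (V : normedModType R[i]) : Prop :=
  forall F : set_system V, ProperFilter F -> cauchy F -> cvg F.

Record hilbert (R : realType) := Hilbert {
  hcarrier :> completeNormedModType R[i] ;
  inner : {dot hcarrier for Num.conj} ;
  _ : forall x : hcarrier, inner x x = `|x| ^+ 2 }.

Notation bounded_op H := (clin H H).
Notation dual V := (clin V (_^o)).

Section Operators.
Context (R : realType) (H : hilbert R).
Implicit Types a b T : bounded_op H.

Definition is_adjoint a b : Prop := forall x y, inner H (a x) y = inner H x (b y).

Lemma op_comp_subproof a b : (a \o b : H -> H) \in @clin_pred R H H.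
Proof.
have [la ca] := clinP a; have [lb cb] := clinP b.
apply/asboolP; split; first by move=> k x y /=; rewrite lb la.
by move=> x; apply: continuous_comp; [exact: cb|exact: ca].
Qed.

Definition op_comp a b : bounded_op H := Clin (op_comp_subproof a b).

Definition compact_op (K : H -> H) : Prop :=
  linear K /\ precompact (K @` [set x | `|x| <= 1]).

(* An unbounded operator; the values of [ufun] outside [udom] are irrelevant. *)
Record unbounded_op := UnboundedOp {
  udom : linear_subspace H ;
  ufun :> H -> H ;
  _ : forall (k : R[i]) x y, sset udom x -> sset udom y ->
    ufun (k *: x + y) = k *: ufun x + ufun y }.

(* D is densely defined and the graph of D equals the graph of its adjoint. *)
Definition selfadjoint (D : unbounded_op) : Prop :=
  closure (sset (udom D)) = setT /\
  forall y z, (sset (udom D) y /\ D y = z) <->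
    (forall x, sset (udom D) x -> inner H (D x) y = inner H x z).

(* T is the bounded extension to H of [D, a], the latter being defined on the
   domain of D, which a is required to preserve. *)
Definition is_commutator (D : unbounded_op) a T : Prop :=
  forall x, sset (udom D) x ->
    sset (udom D) (a x) /\ T x = D (a x) - a (D x).

(* The inverse of 1 + D^2, where D^2 has domain {x in dom D | D x in dom D}.
   For selfadjoint D it is everywhere defined and single-valued. *)
Definition inv_1D2 (D : unbounded_op) : H -> H := fun y =>
  xget 0 [set x | [/\ sset (udom D) x, sset (udom D) (D x) & x + D (D x) = y]].

(* The algebra A is identified with its image in B(H). *)
Record spectral_triple := SpectralTriple {
  alg : linear_subspace (bounded_op H) ;
  alg_mul : forall a b, sset alg a -> sset alg b -> sset alg (op_comp a b) ;
  alg_star : forall a, sset alg a -> exists2 b, sset alg b & is_adjoint a b ;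
  dirac_op : unbounded_op ;
  dirac_op_selfadjoint : selfadjoint dirac_op ;
  comm_bounded : forall a, sset alg a -> exists T, is_commutator dirac_op a T ;
  resolvent_compact : forall a, sset alg a -> compact_op (a \o inv_1D2 dirac_op) }.

End Operators.

Section SpectralDistance.
Context (R : realType) (H : hilbert R) (X : spectral_triple H).

Local Notation A := (alg X).

Definition nabla (a : A) : bounded_op H :=
  projT1 (cid (comm_bounded (subspace_typeP a))).

Definition alg_closure : linear_subspace (bounded_op H) := closure_subspace A.
Local Notation Abar := alg_closure.

Definition alg_incl (a : A) : Abar :=
  @subspace_elt R _ Abar (subspace_val a) (subset_closure (subspace_typeP a)).

(* phi (a^* a) >= 0 for all a, where b is a^* and p is a^* a. *)
Definition positive (phi : dual Abar) : Prop :=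
  forall (a p : Abar) (b : bounded_op H),
    is_adjoint (subspace_val a) b ->
    subspace_val p = op_comp b (subspace_val a) ->
    0 <= (phi p : R[i]).

Definition state (phi : dual Abar) : Prop := positive phi /\ rnorm phi = 1.

Definition restr (phi : dual Abar) : A -> R[i] := fun a => phi (alg_incl a).

Definition spectral_dist (phi psi : dual Abar) : \bar R :=
  ereal_sup [set (rnorm (restr phi a - restr psi a : R[i]^o))%:E |
             a in [set a : A | rnorm (nabla a) <= 1]].

Section Wasserstein.
Context (B : linear_subspace (bounded_op H)) (nablaB : range nabla `<=` sset B).

Definition nabla_in (a : A) : B := subspace_elt (nablaB (imageT nabla a)).

Definition pullback (Phi : dual B) : A -> R[i] := fun a => Phi (nabla_in a).

Definition admissible (phi psi : dual Abar) : set (dual B) :=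
  [set Phi | pullback Phi = restr phi \- restr psi].

Definition wasserstein (phi psi : dual Abar) : \bar R :=
  ereal_inf [set (rnorm Phi)%:E | Phi in admissible phi psi].

End Wasserstein.
End SpectralDistance.

(* Main.v *)
(* Put f := phi_0 - psi_0 and d := d_D(phi, psi).  By homogeneity, finiteness of d
   means |f a| <= d ||nabla a|| for all a in A, so nabla a |-> f a is a well
   defined functional of norm at most d on Im(nabla).  A norm-preserving
   Hahn-Banach extension to B is an admissible Phi with ||Phi|| <= d, while every
   admissible Phi trivially satisfies d <= ||Phi||. *)
Require Import Defs.
From HB Require Import structures.
From mathcomp Require Import all_boot all_order all_algebra.
From mathcomp Require Import all_classical all_reals all_analysis.
From mathcomp Require Import complex ring lra.
Import Order.TTheory GRing.Theory Num.Theory.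
Import numFieldNormedType.Exports.
Local Open Scope classical_set_scope.
Local Open Scope ring_scope.

Set Implicit Arguments.
Unset Strict Implicit.

(** * The real Hahn-Banach theorem for dominated graphs *)

(* In the Hahn-Banach theorems a functional on a subspace is given by its graph G,
   closed under linear combinations; domination of G makes it single-valued. *)
Definition lincomb_closed (K : pzRingType) (V : lmodType K) (G : set V) : Prop :=
  forall (k : K) u v, G u -> G v -> G (k *: u + v).

(** One-step extension: [c] is the value to be given to [x0]. It exists because subadditivity places
    every lower bound [u.2 - p (u.1 - x0)] below every upper bound [p (v.1 + x0) - v.2]; the
    supremum of the lower bounds lies in between. *)
Lemma dominated_extension_value (R : realType) (V : lmodType R) (p : V -> R)
    (A : set (V * R^o)%type) (x0 : V) :
  (forall x y, p (x + y) <= p x + p y) ->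
  A !=set0 -> lincomb_closed A -> (forall u, A u -> u.2 <= p u.1) ->
  exists c : R, forall u, A u -> u.2 + c <= p (u.1 + x0) /\ u.2 - c <= p (u.1 - x0).
Proof.
move=> pD [a0 Aa0] Alin Ap.
pose S := [set (u.2 : R) - p (u.1 - x0) | u in A].
have S_le u v : A u -> A v -> u.2 - p (u.1 - x0) <= p (v.1 + x0) - v.2.
  move=> Au Av; have /Ap /= := Alin 1 _ _ Au Av.
  rewrite !scale1r => uv; have := pD (u.1 - x0) (v.1 + x0).
  rewrite addrACA addNr addr0; lra.
exists (sup S) => u Au; split.
  suff : sup S <= p (u.1 + x0) - u.2 by lra.
  apply: ge_sup; first by exists (a0.2 - p (a0.1 - x0)); exists a0.
  by move=> _ [v Av <-]; exact: S_le.
suff : u.2 - p (u.1 - x0) <= sup S by lra.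
apply: ub_le_sup; last by exists u.
by exists (p (a0.1 + x0) - a0.2) => _ [v Av <-]; exact: S_le.
Qed.

(** Zorn's lemma gives a maximal dominated graph containing [G]. It is total, since a missing point
    could be adjoined by the one-step extension, and domination makes it single-valued. *)
Lemma hahn_banach_real (R : realType) (V : lmodType R) (p : V -> R)
    (G : set (V * R^o)%type) :
  (forall x y, p (x + y) <= p x + p y) ->
  (forall (t : R) x, 0 < t -> p (t *: x) = t * p x) ->
  G !=set0 -> lincomb_closed G -> (forall u, G u -> u.2 <= p u.1) ->
  exists f : V -> R^o,
    [/\ linear f, forall u, G u -> f u.1 = u.2 & forall x, f x <= p x].
Proof.
move=> pD pZ G0 Glin Gp.
(* The empty chain has union set0, which must therefore be allowed. *)
pose P := [set X : set (V * R^o)%type | [/\ lincomb_closed X,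
  forall u, X u -> u.2 <= p u.1 & X !=set0 -> G `<=` X]].
have [A [[Alin Ap GA] Amax]] : exists A, P A /\ forall B, A `<` B -> ~ P B.
  apply: Zorn_bigcup => F FP Ftot; split.
  - move=> k u v [X FX Xu] [Y FY Yv].
    have [XY|YX] := Ftot _ _ FX FY.
      by exists Y => //; have [Ylin _ _] := FP _ FY; apply: Ylin => //; exact: XY.
    by exists X => //; have [Xlin _ _] := FP _ FX; apply: Xlin => //; exact: YX.
  - by move=> u [X FX Xu]; have [_ Xp _] := FP _ FX; exact: Xp.
  - move=> [u [X FX Xu]] v Gv; exists X => //.
    by have [_ _ GX] := FP _ FX; apply: GX => //; exists u.
have A0 : A !=set0.
  (* If the maximal element were empty, [G] itself would be strictly larger. *)
  apply/set0P/negP => /eqP A0; apply: (Amax G); last by split=> // _; exact: subset_refl.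
  by rewrite A0; split=> [? []|GA0]; have [u /GA0] := G0.
have {G0}GA := GA A0; have [a Aa] := A0.
have A00 : A 0.
  by have := Alin (-1) _ _ Aa Aa; rewrite scaleN1r addNr.
have AZ (k : R) u : A u -> A (k *: u).
  by move=> Au; have := Alin k _ _ Au A00; rewrite addr0.
have Atotal x0 : exists r, A (x0, r).
  apply: contrapT => nA.
  have [c cP] := dominated_extension_value x0 pD A0 Alin Ap.
  pose B := [set w : (V * R^o)%type | exists u t, A u /\ w = u + t *: (x0, c : R^o)].
  have AB : A `<=` B by move=> u Au; exists u, 0; rewrite scale0r addr0.
  apply: (Amax B).
    split=> // BA; apply: nA; exists c; apply: BA.
    by exists 0, 1; split=> //; rewrite scale1r add0r.
  split.
  - move=> k _ _ [u [t [Au ->]]] [v [s [Av ->]]].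
    exists (k *: u + v), (k * t + s); split; first exact: Alin.
    by rewrite scalerDr scalerDl !scalerA addrACA.
  - move=> _ [[x r] [t [Au ->]]] /=.
    rewrite -[leLHS]/(r + t * c).
    (* For nonzero [t], a bound of [cP] at [u] divided by [|t|] is multiplied back by [|t|]: the
       first bound serves [t > 0], the second [t < 0]. *)
    have [t0|t0|->] := ltgtP t 0; last first.
    + by rewrite mul0r scale0r !addr0; exact: Ap Au.
    + have [+ _] := cP _ (AZ t^-1 _ Au).
      rewrite -[leLHS]/(t^-1 * r + c) -(ler_pM2l t0) -pZ//= mulrDr scalerDr.
      by rewrite scalerA mulrA divff ?gt_eqF// mul1r scale1r.
    + have nt0 : 0 < - t by rewrite oppr_gt0.
      have [_] := cP _ (AZ (- t)^-1 _ Au).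
      rewrite -[leLHS]/((- t)^-1 * r - c) -(ler_pM2l nt0) -pZ//= mulrBr scalerBr.
      rewrite scalerA mulrA divff ?gt_eqF// mul1r scale1r scaleNr opprK.
      by rewrite mulNr opprK.
  - by move=> _; exact: subset_trans GA AB.
have Afun x r s : A (x, r) -> A (x, s) -> r = s.
  (* Subtraction puts [(0, r' - s')] in [A], so [r' - s' <= p 0]; homogeneity with factor 2 gives
     [p 0 = 2 * p 0], hence [p 0 = 0]. *)
  have le r' s' : A (x, r') -> A (x, s') -> r' <= s'.
    move=> Ar As; have := Ap _ (Alin (-1) _ _ As Ar).
    rewrite /= !scaleN1r addNr.
    have := pZ 2 0; rewrite scaler0 ltr0n => /(_ isT); lra.
  by move=> Ar As; apply/eqP; rewrite eq_le !le.
pose f x := sval (cid (Atotal x)); have fA x : A (x, f x) by rewrite /f; case: cid.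
exists f; split.
- by move=> k x y; apply: Afun (fA _) _; exact: (Alin k _ _ (fA x) (fA y)).
- by move=> [x r] /GA Axr; exact: Afun (fA _) Axr.
- by move=> x; exact: Ap (fA x).
Qed.

(** * The complex Hahn-Banach theorem with a norm bound *)

(** A separate name for the carrier, so that it can bear a module structure over [R] beside the
    given one over [R[i]]. *)
Definition real_scalars (R : realType) (V : lmodType R[i]) : Type := V.

Section RealScalars.
Context (R : realType) (V : lmodType R[i]).

Let real_scale (t : R) (x : V) : V := real_complex R t *: x.

Let real_scaleA (s t : R) (x : V) : real_scale s (real_scale t x) = real_scale (s * t) x.
Proof. by rewrite /real_scale scalerA rmorphM. Qed.

Let real_scale1 : left_id 1 real_scale.
Proof. by move=> x; rewrite /real_scale rmorph1 scale1r. Qed.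

Let real_scaleDr : right_distributive real_scale +%R.
Proof. by move=> t x y; exact: scalerDr. Qed.

Let real_scaleDl x : {morph real_scale^~ x : s t / s + t}.
Proof. by move=> s t; rewrite /real_scale rmorphD scalerDl. Qed.

HB.instance Definition _ := GRing.Zmodule.on (real_scalars V).
HB.instance Definition _ := GRing.Zmodule_isLmodule.Build R (real_scalars V)
  real_scaleA real_scale1 real_scaleDr real_scaleDl.

Lemma real_scalarsZ (t : R) (x : real_scalars V) :
  t *: x = (real_complex R t *: (x : V)).
Proof. by []. Qed.

End RealScalars.

Lemma rnormZ_real (R : realType) (V : normedModType R[i]) (t : R) (x : V) :
  0 < t -> rnorm (real_complex R t *: x) = t * rnorm x.
Proof.
move=> t0; rewrite rnormZ; congr (_ * _).
by rewrite /rnorm normc_def /= expr0n addr0 sqrtr_sqr gtr0_norm.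
Qed.

Lemma rnorm_Re (R : realType) (z : R[i]) : complex.Re z <= rnorm (z : R[i]^o).
Proof.
rewrite /rnorm normc_def /=; apply: le_trans (ler_norm _) _.
by rewrite -sqrtr_sqr ler_wsqrtr// lerDl sqr_ge0.
Qed.

Lemma unimodular_rotation (R : realType) (z : R[i]) :
  exists u : R[i], `|u| = 1 /\ u * z = `|z|.
Proof.
have [->|z0] := eqVneq z 0; first by exists 1; rewrite normr1 mul1r normr0.
exists (`|z| / z); rewrite divfK//; split=> //.
by rewrite normrM normfV normr_id divff ?normr_eq0.
Qed.

Lemma ComplexE (R : realType) (a b : R) :
  Complex a b = real_complex R a + real_complex R b * Complex 0 1.
Proof. by rewrite [LHS]complexE /= mulrC. Qed.

Lemma mul_iC (R : realType) (a b : R) : Complex 0 1 * Complex a b = Complex (- b) a.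
Proof. by apply/eqP; rewrite eq_complex /= !mul0r !mul1r sub0r add0r !eqxx. Qed.

Lemma scale_iC (R : realType) (V : lmodType R[i]) (a b : R) (x : V) :
  Complex 0 1 *: (Complex a b *: x) = Complex (- b) a *: x.
Proof. by rewrite scalerA mul_iC. Qed.

(** The real parts of the values in [G] are dominated by [M * rnorm x], so the real theorem extends
    them; the complex functional rebuilt from this extension keeps the bound [M]. *)
Lemma hahn_banach_dual (R : realType) (V : normedModType R[i]) (M : R)
    (G : set (V * R[i]^o)%type) :
  0 <= M -> G !=set0 -> lincomb_closed G ->
  (forall u, G u -> rnorm u.2 <= M * rnorm u.1) ->
  exists2 Phi : dual V, forall u, G u -> Phi u.1 = u.2 & rnorm Phi <= M.
Proof.
move=> M0 [g0 Gg0] Glin GM.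
pose W := real_scalars V; pose p (x : W) : R := M * rnorm (x : V).
pose Gr := [set w : (W * R^o)%type | exists2 z : R[i], G (w.1, z) & w.2 = complex.Re z].
have [h [hlin hG hp]] : exists h : W -> R^o,
    [/\ linear h, forall w, Gr w -> h w.1 = w.2 & forall x, h x <= p x].
  apply: hahn_banach_real.
  - by move=> x y; rewrite -mulrDr ler_wpM2l// ler_rnormD.
  - by move=> t x t0; rewrite /p real_scalarsZ rnormZ_real// mulrCA.
  - by exists (g0.1, complex.Re g0.2), g0.2 => //; rewrite -surjective_pairing.
  - move=> t [x r] [y s] [z /= Gxz rE] [w /= Gyw sE]; rewrite {}rE {}sE.
    exists (real_complex R t * z + w).
      exact: (Glin (real_complex R t) (x, z) (y, w)).
    by case: z w {Gxz Gyw} => [a b] [c d] /=; rewrite mul0r subr0.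
  - move=> [x r] /= [z /= Gxz ->].
    exact: le_trans (rnorm_Re z) (GM _ Gxz).
pose i : R[i] := Complex 0 1.
(* A complex functional is determined by its real part h: it is x |-> h x - i h(ix). *)
pose f (x : V) : R[i]^o := Complex (h x) (- h (i *: x)).
have hD (x y : V) : h (x + y : V) = h x + h y.
  by have := hlin 1 x y; rewrite !scale1r.
have h0 : h (0 : V) = 0.
  by have := hD 0 0; rewrite addr0 -[LHS]addr0 => /addrI.
have hZ (t : R) (x : V) : h (real_complex R t *: x : V) = t * h x.
  by have := hlin t x 0; rewrite h0 !addr0.
have hZc (a b : R) (x : V) : h (Complex a b *: x : V) = a * h x + b * h (i *: x).
  rewrite -!hZ -hD [Complex a b](_ : _ = real_complex R a + real_complex R b * i).
    by rewrite scalerDl scalerA.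
  exact: ComplexE.
have hiZ (a b : R) (x : V) :
    h (i *: (Complex a b *: x) : V) = - b * h x + a * h (i *: x).
  by rewrite /i scale_iC; exact: hZc.
have flin : linear f.
  move=> [a b] x y.
  rewrite /f [i *: (_ + _)]scalerDr !hD hZc hiZ.
  rewrite -[RHS]/(Complex (a * h x - b * - h (i *: x) + h y)
    (a * - h (i *: x) + b * h x - h (i *: y))).
  by congr Complex; ring.
have fM x : rnorm (f x) <= M * rnorm x.
  (* Rotating x makes f x real, so that h controls its modulus. *)
  have [u [u1 ufx]] := unimodular_rotation (f x).
  have fu : f (u *: x) = `|f x|.
    by rewrite -ufx; have := flin u x 0; rewrite !addr0 /f scaler0 h0 oppr0 addr0.
  have -> : rnorm (f x) = h (u *: x) by rewrite /rnorm -fu.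
  apply: le_trans (hp _) _; rewrite /p rnormZ [rnorm u](_ : _ = 1) ?mul1r//.
  by rewrite /rnorm u1.
have fcont : continuous f.
  pose F : {linear V -> R[i]^o} := HB.pack f (GRing.isLinear.Build _ _ _ _ f flin).
  apply: (@bounded_linear_continuous _ _ _ F); apply/linear_boundedP.
  exists (real_complex R M); split; first by rewrite complex_real.
  move=> r /ltW Mr x; apply: (@le_trans _ _ (real_complex R M * `|x|)).
    by rewrite -!rnormE -rmorphM lecR; exact: fM.
  by rewrite ler_wpM2r.
have fP : f \in @clin_pred R V (R[i]^o) by apply/asboolP.
exists (Clin fP); last by rewrite rnorm_clinE; exact: opnorm_le.
move=> [x z] Gxz /=; rewrite /f.
have -> : h x = complex.Re z by apply: (hG (x, complex.Re z)); exists z.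
(* Complex linearity puts [(i *: x, i * z)] in [G], and [- Re (i * z)] is the imaginary part of
   [z]. *)
have -> : h (i *: x) = complex.Re (i * z).
  apply: (hG (i *: x, complex.Re (i * z))); exists (i * z) => //.
  have G00 : G 0 by have := Glin (-1) _ _ Gxz Gxz; rewrite scaleN1r addNr.
  by have := Glin i _ _ Gxz G00; rewrite addr0.
by case: z {Gxz} => a b /=; congr Complex; ring.
Qed.

(** * Linearity of the commutator map *)

Lemma clin_eq_dense (R : realType) (V W : normedModType R[i]) (E : set V)
    (S T : clin V W) :
  closure E = setT -> (forall x, E x -> S x = T x) -> S = T.
Proof.
move=> Edense ST; apply/val_inj/funext => x /=; apply/eqP.
rewrite -subr_eq0; apply: contraT => nz.
(* The open ball of this radius around [S x - T x] omits 0, whereas density supplies a nearby [y] in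
   [E] with [S y - T y = 0]. *)
have /cvgrPdist_lt/(_ `|S x - T x|) : (fun y => S y - T y) @ x --> S x - T x.
  by apply: cvgB; [exact: (clinP S).2|exact: (clinP T).2].
rewrite normr_gt0 => /(_ nz) near_x.
have : closure E x by rewrite Edense.
move=> /(_ _ near_x) [y [Ey /=]].
by rewrite (ST y Ey) subrr subr0 ltxx.
Qed.

Lemma nabla_comm (R : realType) (H : hilbert R) (X : spectral_triple H) (a : alg X) :
  is_commutator (dirac_op X) (subspace_val a) (nabla a).
Proof. exact: projT2 (cid _). Qed.

(** [nabla a] is obtained by choice, but its values on the dense domain of the Dirac operator are
    prescribed, and there the commutator is linear in [a]. *)
Lemma nabla_linear (R : realType) (H : hilbert R) (X : spectral_triple H) :
  linear (@nabla R H X).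
Proof.
move=> k a b; have [Ddense _] := dirac_op_selfadjoint X.
apply: (clin_eq_dense Ddense) => x Dx.
have [Dax Tax] := nabla_comm a Dx.
have [Dbx Tbx] := nabla_comm b Dx.
have [_ ->] := nabla_comm (k *: a + b) Dx.
rewrite [RHS](_ : _ = k *: nabla a x + nabla b x)// Tax Tbx.
case: (dirac_op X) Dx Dax Dbx => dom D Dlin /= Dx Dax Dbx.
rewrite -[LHS]/(D (k *: subspace_val a x + subspace_val b x) -
  (k *: subspace_val a (D x) + subspace_val b (D x))) Dlin//.
by rewrite scalerBr opprD addrACA.
Qed.

(** * Spectral distance as a minimal dual norm *)

(** Homogeneity, including the kernel of [N]: the conclusion makes [f] vanish there, so that [f]
    factors through the image of [N]. *)
Lemma bound_of_unit_bound (R : realType) (E : lmodType R[i])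
    (V W : normedModType R[i]) (N : {linear E -> V}) (f : {linear E -> W}) (d : R) :
  (forall a, rnorm (N a) <= 1 -> rnorm (f a) <= d) ->
  forall a, rnorm (f a) <= d * rnorm (N a).
Proof.
move=> fd a.
have d0 : 0 <= d.
  by apply: le_trans (fd 0 _); rewrite linear0 /rnorm normr0 // ler01.
(* Adding 1 keeps the denominator positive when [d = 0], and still [d * (e / (d + 1)) <= e]. *)
have d1 : 0 < d + 1 by rewrite ltr_pwDr.
(* N a may vanish, so a is rescaled by a slightly larger number. *)
apply/ler_addgt0Pr => e e0; pose s := rnorm (N a) + e / (d + 1).
have s0 : 0 < s by rewrite ltr_wpDl ?rnorm_ge0 ?divr_gt0.
have := fd (real_complex R s^-1 *: a).
rewrite !linearZ !rnormZ_real ?invr_gt0// mulrC ler_pdivrMr// mul1r lerDl.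
rewrite ltW ?divr_gt0// => /(_ isT); rewrite mulrC ler_pdivrMr// => /le_trans; apply.
rewrite mulrDr lerD2l mulrA ler_pdivrMr// mulrC ler_wpM2l ?(ltW e0)//; lra.
Qed.

Section Duality.
Context (R : realType) (H : hilbert R) (X : spectral_triple H).
Context (phi psi : dual (alg_closure X)).

Lemma restr_linear (chi : dual (alg_closure X)) :
  linear (restr chi : alg X -> R[i]^o).
Proof.
move=> k a b; rewrite /restr -[RHS](clinP chi).1; congr (clin_fun chi).
exact: val_inj.
Qed.

Lemma restrB_linear :
  linear (fun a : alg X => restr phi a - restr psi a : R[i]^o).
Proof.
move=> k a b; rewrite !restr_linear scalerBr opprD !addrA.
by congr (_ - _); rewrite addrAC.
Qed.

(** The element 0 satisfies the constraint, so the supremum is not over the empty set and cannot be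
    [-oo]. *)
Lemma spectral_dist_ge0 : (0 <= spectral_dist phi psi)%E.
Proof.
have nabla0 : rnorm (nabla (0 : alg X)) = 0.
  have := nabla_linear (-1) (0 : alg X) 0.
  by rewrite !scaleN1r !addNr => ->; rewrite /rnorm normr0.
apply: le_ereal_sup_tmp; exists (rnorm (restr phi 0 - restr psi 0 : R[i]^o))%:E.
  by exists 0 => //=; rewrite nabla0 ler01.
by rewrite lee_fin rnorm_ge0.
Qed.

Context (B : linear_subspace (bounded_op H)) (hIm : range (@nabla R H X) `<=` sset B).

Lemma spectral_dist_le_admissible (Phi : dual B) :
  admissible hIm phi psi Phi -> (spectral_dist phi psi <= (rnorm Phi)%:E)%E.
Proof.
move=> adm; apply: ge_ereal_sup => _ [a /= a1 <-]; rewrite lee_fin.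
have <- : pullback hIm Phi a = restr phi a - restr psi a by rewrite adm.
apply: le_trans (opnorm_ub Phi (nabla_in hIm a)) _.
by rewrite rnorm_clinE ler_piMr ?opnorm_ge0.
Qed.

Lemma admissible_le (d : R) : spectral_dist phi psi = d%:E ->
  exists2 Phi : dual B, admissible hIm phi psi Phi & rnorm Phi <= d.
Proof.
move=> distE.
pose g (a : alg X) : R[i]^o := restr phi a - restr psi a.
pose f : {linear alg X -> R[i]^o} := HB.pack g
  (GRing.isLinear.Build _ _ _ _ g restrB_linear).
pose N : {linear alg X -> bounded_op H} := HB.pack (@nabla R H X)
  (GRing.isLinear.Build _ _ _ _ (@nabla R H X) (@nabla_linear R H X)).
have fN : forall a, rnorm (f a) <= d * rnorm (N a).
  apply: bound_of_unit_bound => a a1; rewrite -lee_fin -distE.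
  by apply: ereal_sup_ubound; exists a.
have d0 : 0 <= d by rewrite -lee_fin -distE spectral_dist_ge0.
(* The functional sending [nabla a] to [f a] enters as its graph, and [fN] is the required
   domination. *)
have [||_ [a _ <-]|Phi PhiE Phid] := @hahn_banach_dual R B d
  (range (fun a => (nabla_in hIm a, f a))) d0.
- by exists (nabla_in hIm 0, f 0); exists 0.
- move=> k _ _ [a _ <-] [b _ <-]; exists (k *: a + b) => //.
  rewrite linearP; congr pair; apply: val_inj; exact: nabla_linear.
- exact: fN.
exists Phi => //; apply/funext => a.
by apply: (PhiE (nabla_in hIm a, f a)); exists a.
Qed.

Lemma wasserstein_duality : (spectral_dist phi psi < +oo)%E ->
  exists2 Phi : dual B, admissible hIm phi psi Phi &
    (rnorm Phi)%:E = wasserstein hIm phi psi /\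
    wasserstein hIm phi psi = spectral_dist phi psi.
Proof.
move=> hfin.
have distE : spectral_dist phi psi = (fine (spectral_dist phi psi))%:E.
  by rewrite fineK// ge0_fin_numE// spectral_dist_ge0.
have [Phi adm Phid] := admissible_le distE.
have WD : wasserstein hIm phi psi = spectral_dist phi psi.
  apply/eqP; rewrite eq_le; apply/andP; split.
    apply: ge_ereal_inf; exists (rnorm Phi)%:E; first by exists Phi.
    by rewrite distE lee_fin.
  apply: le_ereal_inf_tmp => _ [Psi admPsi <-].
  exact: spectral_dist_le_admissible.
(* The extension attains the infimum: its norm is at most the distance, and admissibility gives the
   converse. *)
exists Phi => //; split=> //; apply/eqP; rewrite WD eq_le.
by rewrite spectral_dist_le_admissible// distE lee_fin Phid.
Qed.

End Duality.

Unset Implicit Arguments.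
Set Strict Implicit.

Theorem theorem1 (R : realType) (H : hilbert R) (X : spectral_triple H)
    (phi psi : dual (alg_closure X))
    (hphi : state phi) (hpsi : state psi)
    (hfin : (spectral_dist phi psi < +oo)%E)
    (B : linear_subspace (bounded_op H)) (hB : banach B)
    (hIm : range (@nabla R H X) `<=` sset B) :
  [/\ admissible hIm phi psi !=set0,
      exists2 Phi : dual B, admissible hIm phi psi Phi &
        (rnorm Phi)%:E = wasserstein hIm phi psi,
      wasserstein hIm phi psi = spectral_dist phi psi &
      forall (B' : linear_subspace (bounded_op H)) (hB' : banach B')
        (hIm' : range (@nabla R H X) `<=` sset B'),
        wasserstein hIm' phi psi = wasserstein hIm phi psi].
Proof.
have [Phi adm [PhiW WD]] := wasserstein_duality hIm hfin.
split=> //; [by exists Phi|by exists Phi|].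
(* Both infima equal [spectral_dist phi psi], which does not refer to the subspace. *)
move=> B' _ hIm'; have [_ _ [_ ->]] := wasserstein_duality hIm' hfin.
by rewrite WD.
Qed.
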